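(* Let $\mathcal{F}$ be a Hilbert space, let $h:\mathbb{R}^p\to\mathcal{F}$ be differentiable with locally Lipschitz differential $Dh$, let $w_0\in\mathbb{R}^p$, and let $R(y)=\frac12\|y-y^\star\|^2$ for some $y^\star\in\mathcal{F}$. Assume that for some $r>0$, on the ball of radius $r$ around $w_0$, $h$ is $\mathrm{Lip}(h)$-Lipschitz and $Dh$ is $\mathrm{Lip}(Dh)$-Lipschitz, with $\mathrm{Lip}(h)>0$. Let $\alpha>0$ with $\alpha h(w_0)\neq y^\star$, let $w_\alpha$ and $\bar w_\alpha$ be the gradient flows, started from $w_0$, of the scaled objective $F_\alpha$ and of the scaled linearized objective $\bar F_\alpha$ (as defined in the context), let $K>0$ and let $T:=K/\mathrm{Lip}(h)^2$. If $$\alpha\ \ge\ \frac{K\,\|\alpha h(w_0)-y^\star\|}{r\,\mathrm{Lip}(h)},$$ then $$\frac{\|\alpha h(w_\alpha(T))-\alpha\bar h(\bar w_\alpha(T))\|}{\|\alpha h(w_0)-y^\star\|}\ \le\ \frac{K^2}{\alpha}\,\frac{\mathrm{Lip}(Dh)}{\mathrm{Lip}(h)^2}\,\|\alpha h(w_0)-y^\star\|.$$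
   Context: $Dh(w):\mathbb{R}^p\to\mathcal{F}$ denotes the differential of $h$ at $w$, a continuous linear map, and $Dh(w)^\intercal$ its adjoint; Lipschitz continuity of $w\mapsto Dh(w)$ is with respect to the operator norm. The linearized model at $w_0$ is $\bar h(w) := h(w_0)+Dh(w_0)(w-w_0)$. For $\alpha>0$, set $$F_\alpha(w):=\frac{1}{\alpha^2}R(\alpha h(w)),\qquad \bar F_\alpha(w):=\frac{1}{\alpha^2}R(\alpha\bar h(w)).$$ The gradient flow $(w_\alpha(t))_{t\ge 0}$ of $F_\alpha$ satisfies $w_\alpha(0)=w_0$ and $$w_\alpha'(t)=-\nabla F_\alpha(w_\alpha(t))=-\frac1\alpha Dh(w_\alpha(t))^\intercal\nabla R(\alpha h(w_\alpha(t))).$$ The gradient flow $(\bar w_\alpha(t))_{t\ge 0}$ of $\bar F_\alpha$ satisfies $\bar w_\alpha(0)=w_0$ and $$\bar w_\alpha'(t)=-\nabla\bar F_\alpha(\bar w_\alpha(t))=-\frac1\alpha Dh(w_0)^\intercal\nabla R(\alpha\bar h(\bar w_\alpha(t))).$$ The number $K$ is a positive real, analogous to an iteration number. *)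

(* Defs.v *)
From HB Require Import structures.
From mathcomp Require Import all_boot all_order all_algebra.
From mathcomp Require Import all_classical all_reals all_analysis.
From mathcomp Require Import sesquilinear ring lra.

Set Implicit Arguments.
Unset Strict Implicit.
Unset Printing Implicit Defensive.

Import Order.TTheory GRing.Theory Num.Theory.
Import numFieldNormedType.Exports.

Local Open Scope classical_set_scope.
Local Open Scope ring_scope.

HB.mixin Record CompleteNormedModule_isHilbert (R : realType) V
    of CompleteNormedModule R V := {
  inner : {dot V for idfun} ;
  inner_norm : forall x : V, inner x x = `|x| ^+ 2
}.

#[short(type="hilbertType")]
HB.structure Definition Hilbert (R : realType) :=
  {V of CompleteNormedModule R V & CompleteNormedModule_isHilbert R V}.

Section Euclidean.
Context {R : realType} {p : nat}.
Implicit Types (u v : 'rV[R]_p).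

Definition edot u v : R := \sum_(i < p) u 0 i * v 0 i.

(* The library's norm on row vectors is the sup norm; it induces the same
   topology, hence the same differentials, as this one. *)
Definition enorm u : R := Num.sqrt (edot u u).

Definition eball (c : 'rV[R]_p) (r : R) : set 'rV[R]_p :=
  [set u | enorm (u - c) < r].

Definition grad (f : 'rV[R]_p -> R) (w : 'rV[R]_p) : 'rV[R]_p :=
  \row_i 'd f w (delta_mx 0 i).

Section maps.
Context {F : normedModType R}.

(* A genuine supremum when L is linear and continuous; [sup] is 0 on an
   unbounded set. *)
Definition opnorm (L : 'rV[R]_p -> F) : R :=
  sup [set `|L v| | v in [set v | enorm v <= 1]].

Definition elipschitz (k : R) (A : set 'rV[R]_p) (f : 'rV[R]_p -> F) :=
  forall u v, A u -> A v -> `|f u - f v| <= k * enorm (u - v).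

Definition diff_lipschitz (k : R) (A : set 'rV[R]_p) (f : 'rV[R]_p -> F) :=
  forall u v, A u -> A v ->
    opnorm (fun x => 'd f u x - 'd f v x) <= k * enorm (u - v).

Definition diff_locally_lipschitz (f : 'rV[R]_p -> F) :=
  forall w, exists rho k : R,
    0 < rho /\ diff_lipschitz k (eball w rho) f.
End maps.

(* On the half-line, the derivative at time 0 is the right derivative. *)
Definition gradient_flow (f : 'rV[R]_p -> R) (w0 : 'rV[R]_p)
    (w : R -> 'rV[R]_p) :=
  [/\ w 0 = w0,
      s^-1 *: (w s - w 0) @[s --> 0^'+] --> - grad f (w 0) &
      forall t : R, 0 < t -> is_derive t 1 w (- grad f (w t))].

End Euclidean.

Section Objective.
Context {R : realType} {p : nat} {F : normedModType R}.

Definition square_loss (ystar y : F) : R := 2^-1 * `|y - ystar| ^+ 2.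

Definition linearized (h : 'rV[R]_p -> F) (w0 w : 'rV[R]_p) : F :=
  h w0 + 'd h w0 (w - w0).

Definition scaled_objective (L : F -> R) (alpha : R) (g : 'rV[R]_p -> F)
    (w : 'rV[R]_p) : R :=
  (alpha ^+ 2)^-1 * L (alpha *: g w).

End Objective.

Section Hilbert_theory.
Context {R : realType} {F : hilbertType R}.
Implicit Types x y z : F.

Lemma innerC x y : inner x y = inner y x :> R.
Proof. by rewrite hermitian_subproof expr0 mul1r. Qed.

Lemma normD_inner x y : `|x + y| ^+ 2 = `|x| ^+ 2 + 2 * inner x y + `|y| ^+ 2.
Proof.
by rewrite -!inner_norm linearDl !linearDr/= (innerC y x); ring.
Qed.

Lemma ler_inner x y : `|inner x y : R| <= `|x| * `|y|.
Proof.
suff H (a b : F) : inner a b <= `|a| * `|b| :> R.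
  by rewrite ler_norml H lerNl -linearNl -(normrN x) H.
have : `|a + b| ^+ 2 <= (`|a| + `|b|) ^+ 2 :> R.
  by rewrite lerXn2r ?nnegrE ?addr_ge0 ?ler_normD.
by rewrite normD_inner; nra.
Qed.

Lemma is_diff_square_loss (ystar y : F) :
  is_diff y (square_loss ystar) (fun v => inner v (y - ystar)).
Proof.
have lin : linear (fun v => inner v (y - ystar) : R).
  by move=> a u v; rewrite linearDl linearZl_LR.
pose lM := GRing.isLinear.Build _ _ _ _ _ lin.
pose l : {linear F -> R} := HB.pack (fun v => inner v (y - ystar) : R) lM.
have lc : continuous l.
  apply/linear_bounded_continuous/linear_boundedP.
  exists `|y - ystar|; split => [|M yM v]; first exact: normr_real.
  rewrite (le_trans (ler_inner _ _))// mulrC ler_wpM2r//.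
  exact: ltW.
have E : square_loss ystar \o shift y = cst (square_loss ystar y) + l +o_ 0 id.
  apply/eqaddoP => _/posnumP[e].
  near=> v.
  have -> : ((square_loss ystar \o shift y) - (cst (square_loss ystar y) + l)) v
      = 2^-1 * `|v| ^+ 2.
    change (2^-1 * `|v + y - ystar| ^+ 2 - (2^-1 * `|y - ystar| ^+ 2 +
      inner v (y - ystar)) = 2^-1 * `|v| ^+ 2 :> R).
    by rewrite -(addrA v) (normD_inner v); field.
  rewrite ger0_norm ?mulr_ge0//= expr2 mulrA ler_wpM2r//.
  rewrite mulrC ler_pdivrMr//.
have dl : 'd (square_loss ystar) y = l :> (F -> R) by exact: diff_unique.
by apply: DiffDef; [apply/diff_locallyP; rewrite dl|exact: dl].
Unshelve. all: by end_near. Qed.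

End Hilbert_theory.

Section Adjoint.
Context {R : realType} {p : nat} {F : hilbertType R}.

Definition adjoint (L : 'rV[R]_p -> F) (y : F) : 'rV[R]_p :=
  \row_i inner (L (delta_mx 0 i)) y.

Lemma adjointP (L : {linear 'rV[R]_p -> F}) y v :
  inner (L v) y = edot v (adjoint L y).
Proof.
rewrite [in LHS](row_sum_delta v) linear_sum linear_sumlz.
by apply: eq_bigr => i _; rewrite mxE linearZ/= linearZl_LR.
Qed.

Lemma diff_grad (f : 'rV[R]_p -> R) w v : 'd f w v = edot v (grad f w).
Proof.
rewrite [in LHS](row_sum_delta v) linear_sum.
by apply: eq_bigr => i _; rewrite mxE linearZ.
Qed.

Lemma grad_scaled_square_loss (g : 'rV[R]_p -> F) ystar (alpha : R) w :
  alpha != 0 -> differentiable g w ->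
  grad (scaled_objective (square_loss ystar) alpha g) w =
  alpha^-1 *: adjoint ('d g w) (alpha *: g w - ystar).
Proof.
move=> a0 /differentiableP gw.
have ls := is_diff_square_loss ystar (alpha *: g w).
have D : is_diff w (scaled_objective (square_loss ystar) alpha g)
    ((alpha ^+ 2)^-1 *: ((fun v => inner v (alpha *: g w - ystar)) \o
      (alpha *: ('d g w : _ -> _)))).
  have ag : is_diff w (alpha *: g) (alpha *: ('d g w : _ -> _)) by exact: is_diffZ.
  exact: (@is_diffZ _ _ _ (square_loss ystar \o (alpha *: g))).
apply/rowP => i; rewrite !mxE diff_val.
change ((alpha ^+ 2)^-1 * inner (alpha *: 'd g w (delta_mx 0 i))
  (alpha *: g w - ystar) = alpha^-1 * inner ('d g w (delta_mx 0 i))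
  (alpha *: g w - ystar) :> R).
by rewrite linearZl_LR/=; field.
Qed.

End Adjoint.

(* Main.v *)
From HB Require Import structures.
Require Import Defs.
From mathcomp Require Import all_boot all_order all_algebra.
From mathcomp Require Import all_classical all_reals all_analysis.
From mathcomp Require Import sesquilinear ring lra.

Import Order.TTheory GRing.Theory Num.Theory.
Import numFieldNormedType.Exports.

(** Write e(t) = alpha h(w(t)) - y* and e0(t) = alpha hbar(wbar(t)) - y* for
    the two residuals, A(t) = Dh(w(t)), A0 = Dh(w0) and D = |e(0)| = |e0(0)|.
    By the chain rule ([residual_ray_derive]) both residuals solve an equation
    in the output space, e' = - A A^T e and e0' = - A0 A0^T e0, from the same
    starting point. The two equations differ only through A A^T - A0 A0^T.

    This operator is small because the weights hardly move. The norm of e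
    decreases ([residual_le]), so the speed |w'| = |A^T e| / alpha is at most
    v = Lip(h) D / alpha as long as w stays in the ball; the lower bound on
    alpha says exactly that v T <= r, hence w cannot leave the ball before T
    and |w(t) - w0| <= v t ([gradient_flow_drift]). Therefore
    |A(t) - A0| <= Lip(Dh) v t.

    Differentiating |e - e0|^2, the part of the right-hand side that acts on
    e - e0 through A0 A0^T is dissipative and can be dropped, which leaves
      (|e - e0|^2)' <= 2 (2 Lip(h) Lip(Dh) v t |e|) |e - e0|
    ([gram_gap]). With |e| <= D this gives |e - e0|' <= 2 k t for
    k = Lip(h) Lip(Dh) v D ([sqrt_growth] makes this rigorous where the norm
    vanishes), so |e(T) - e0(T)| <= k T^2, which is the stated bound times D.
    Dropping the dissipative term, rather than estimating it, is what avoids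
    the exponential factor of a Gronwall argument. *)

Local Open Scope classical_set_scope.
Local Open Scope ring_scope.

Set Implicit Arguments.
Unset Strict Implicit.
Unset Printing Implicit Defensive.

(** * Derivatives along a half-line *)

Section HalfLine.
Context {R : realType}.
Implicit Types (V W : normedModType R).

(** The derivative is asked for at positive times only; at 0 right continuity
    is enough for the mean value theorem on [0, b] and, unlike a right
    derivative, it is stable under composition without a one-sided chain
    rule. *)
Definition ray_derive {V} (f df : R -> V) :=
  f @ 0^'+ --> f 0 /\ forall t : R, 0 < t -> is_derive t 1 f (df t).

Lemma ray_derive_cvg_right {V} (f df : R -> V) (t : R) :
  ray_derive f df -> 0 <= t -> f @ t^'+ --> f t.
Proof.
move=> [f0 fd]; rewrite le_eqVlt => /predU1P[<-//|t0].
have [ft _] := fd t t0.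
apply: cvg_at_right_filter.
exact/differentiable_continuous/derivable1_diffP.
Qed.

Lemma ray_derive_continuous {V} (f df : R -> V) (t : R) :
  ray_derive f df -> 0 < t -> {for t, continuous f}.
Proof.
move=> [_ fd] t0; have [ft _] := fd t t0.
exact/differentiable_continuous/derivable1_diffP.
Qed.

Lemma ray_derive_within (f df : R -> R) (b : R) :
  ray_derive f df -> 0 < b -> {within `[0, b], continuous f}.
Proof.
move=> fd b0; apply/continuous_within_itvP => //; split.
- move=> t; rewrite in_itv/= => /andP[t0 _]; exact: ray_derive_continuous fd t0.
- by case: fd.
- apply: cvg_at_left_filter; exact: ray_derive_continuous fd b0.
Qed.

Lemma ray_derive_comp {V W} (g : V -> W) (f df : R -> V) :
  (forall x, differentiable g x) -> ray_derive f df ->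
  ray_derive (g \o f) (fun t => 'd g (f t) (df t)).
Proof.
move=> gd [f0 fd]; split=> [|t t0].
  apply: continuous_cvg => //; exact: differentiable_continuous.
have [/derivable1_diffP ft <-] := fd t t0.
have gft : differentiable (g \o f) t by exact: differentiable_comp.
split; first exact/derivable1_diffP.
by rewrite !deriveE// diff_comp.
Qed.

Lemma ray_derive_cst {V} (c : V) :
  ray_derive (fun _ => c) (fun _ => 0 : V).
Proof. by split=> [|t t0]; [exact: cvg_cst|exact: is_derive_cst]. Qed.

Lemma ray_deriveB {V} (f df g dg : R -> V) :
  ray_derive f df -> ray_derive g dg -> ray_derive (f \- g) (df \- dg).
Proof.
move=> [f0 fd] [g0 gd]; split; first exact: cvgB.
by move=> t t0; have := fd t t0; have := gd t t0 => ? ?; apply: is_deriveB.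
Qed.

Lemma ray_derive_nonincreasing (f df : R -> R) (b : R) : 0 <= b ->
  ray_derive f df -> (forall t, 0 < t < b -> df t <= 0) -> f b <= f 0.
Proof.
rewrite le_eqVlt => /predU1P[<-//|b0] fd df0.
have [_ fd'] := fd.
have [] := @MVT R f df 0 b b0.
- by move=> t; rewrite in_itv/= => /andP[/fd'].
- exact: ray_derive_within fd b0.
move=> t; rewrite in_itv/= => /df0 dft E.
by rewrite -subr_le0 E mulr_le0_ge0// subr0 ltW.
Qed.

(** N stands for the square of a norm |f|, and the hypothesis on its derivative
    for |f|' <= g'. Since |f| need not be differentiable where it vanishes,
    the mean value theorem is applied to sqrt (N + e^2) - g, which is smooth
    and nonincreasing, and e tends to 0. *)
Lemma sqrt_growth (N dN g dg : R -> R) (b : R) : 0 <= b ->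
  ray_derive N dN -> ray_derive g dg -> (forall t, 0 <= N t) -> N 0 = 0 ->
  (forall t, 0 < t < b -> 0 <= dg t) ->
  (forall t, 0 < t < b -> dN t <= 2 * dg t * Num.sqrt (N t)) ->
  Num.sqrt (N b) <= g b - g 0.
Proof.
move=> b0 [N0 Nd] [g0 gd] Nge N00 dg0 dN0.
apply/ler_addgt0Pr => e e0.
have Ne t : 0 < N t + e ^+ 2 by rewrite ltr_wpDl// exprn_gt0.
pose f t := Num.sqrt (N t + e ^+ 2).
have fC : ray_derive (f \- g)
    (fun t => (2 * Num.sqrt (N t + e ^+ 2))^-1 * dN t - dg t).
  apply: ray_deriveB => //; split.
    apply: (@cvg_comp _ _ _ (fun t => N t + e ^+ 2) Num.sqrt _
      (nbhs (N 0 + e ^+ 2))).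
      by apply: cvgD => //; exact: cvg_cst.
    exact: sqrt_continuous.
  move=> t t0.
  have Nt := Nd _ t0.
  have E : is_derive t 1 (fun t => N t + e ^+ 2) (dN t).
    by apply: is_derive_eq; rewrite addr0.
  have D := is_derive1_sqrt (Ne t).
  exact: (@is_derive1_comp _ Num.sqrt (fun t => N t + e ^+ 2) t _ _ D E).
have := ray_derive_nonincreasing b0 fC.
have -> : (f \- g) 0 = e - g 0 by rewrite /= /f N00 add0r sqrtr_sqr gtr0_norm.
move=> /(_ _)/wrap[t tb|].
  have s0 : 0 < Num.sqrt (N t + e ^+ 2) by rewrite sqrtr_gt0.
  have sle : Num.sqrt (N t) <= Num.sqrt (N t + e ^+ 2).
    by rewrite ler_wsqrtr// lerDl sqr_ge0.
  rewrite subr_le0 mulrC ler_pdivrMr ?mulr_gt0//.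
  apply: (le_trans (dN0 _ tb)).
  by rewrite mulrA (mulrC _ 2) ler_wpM2l// mulr_ge0// dg0.
rewrite /= -/(f b) => H.
have : Num.sqrt (N b) <= f b by rewrite ler_wsqrtr// lerDl sqr_ge0.
lra.
Qed.

(** The first exit time is the infimum of the exit times; right continuity
    suffices for it to be an exit time itself, because there are
    exit times at or just to the right of it. *)
Lemma first_exit (phi : R -> R) (r b : R) : 0 <= b ->
  (forall t, 0 <= t -> phi @ t^'+ --> phi t) -> r <= phi b ->
  exists2 tau, 0 <= tau <= b & r <= phi tau /\
    forall s, 0 <= s < tau -> phi s < r.
Proof.
move=> b0 cphi rb.
pose S := [set t | 0 <= t <= b /\ r <= phi t].
have Sb : S b by split=> //; rewrite b0 lexx.
have lbS : lbound S 0 by move=> t [/andP[]].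
have iS : has_inf S by split; [exists b|exists 0].
have tau0 : 0 <= inf S by apply: lb_le_inf => //; exists b.
have taub : inf S <= b by apply: ge_inf => //; exists 0.
exists (inf S); first by rewrite tau0.
split; last first.
  move=> s /andP[s0 st]; rewrite ltNge; apply/negP => rs.
  have : inf S <= s.
    by apply: ge_inf; [exists 0|split=> //; rewrite s0 (le_trans (ltW st))].
  by rewrite leNgt st.
rewrite leNgt; apply/negP => pr.
have : \forall s \near (inf S)^'+, phi s < r.
  by apply: (cvgr_lt (phi (inf S))) => //; exact: cphi.
move=> /nbhs_ballP[e /= e0 He].
have [s Ss se] := inf_adherent e0 iS.
have [s0 rs] := Ss.
have := ge_inf iS.2 Ss; rewrite le_eqVlt => /predU1P[E|tau_s].
  by move: pr; rewrite E ltNge rs.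
have : phi s < r.
  by apply: He => //; rewrite /ball/= ltr_distlC; apply/andP; split=> //; lra.
by rewrite ltNge rs.
Qed.
End HalfLine.

(** * Euclidean norm, operator norm and adjoint *)

Section Euclid.
Context {R : realType} {p : nat}.
Implicit Types (u v : 'rV[R]_p).

Lemma edotC u v : edot u v = edot v u.
Proof. by apply: eq_bigr => i _; rewrite mulrC. Qed.

Lemma edotDl u1 u2 v : edot (u1 + u2) v = edot u1 v + edot u2 v.
Proof. by rewrite -big_split; apply: eq_bigr => i _; rewrite mxE mulrDl. Qed.

Lemma edotZl (a : R) u v : edot (a *: u) v = a * edot u v.
Proof. by rewrite mulr_sumr; apply: eq_bigr => i _; rewrite mxE mulrA. Qed.

Lemma edotNl u v : edot (- u) v = - edot u v.
Proof. by rewrite -scaleN1r edotZl mulN1r. Qed.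

Lemma edot_ge0 u : 0 <= edot u u.
Proof. by apply: sumr_ge0 => i _; rewrite -expr2 sqr_ge0. Qed.

Lemma sqr_enorm u : enorm u ^+ 2 = edot u u.
Proof. by rewrite sqr_sqrtr// edot_ge0. Qed.

Lemma enorm_ge0 u : 0 <= enorm u.
Proof. exact: sqrtr_ge0. Qed.

Lemma enormZ (a : R) u : enorm (a *: u) = `|a| * enorm u.
Proof.
by rewrite /enorm edotZl edotC edotZl mulrA -expr2 sqrtrM ?sqr_ge0// sqrtr_sqr.
Qed.

Lemma enormN u : enorm (- u) = enorm u.
Proof. by rewrite -scaleN1r enormZ normrN1 mul1r. Qed.

Lemma coord_le_enorm u i : `|u 0 i| <= enorm u.
Proof.
rewrite -sqrtr_sqr ler_sqrt ?edot_ge0// /edot (bigD1 i)//= -expr2 lerDl.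
by apply: sumr_ge0 => j _; rewrite -expr2 sqr_ge0.
Qed.

Lemma enorm_eq0 u : enorm u = 0 -> u = 0.
Proof.
move=> u0; apply/rowP => i; rewrite mxE; apply: normr0_eq0; apply/eqP.
by rewrite eq_le normr_ge0 andbT -u0 coord_le_enorm.
Qed.

Lemma edot_le_enorm u v : edot u v <= enorm u * enorm v.
Proof.
have [u0|un0] := eqVneq (enorm u) 0.
  by rewrite u0 mul0r (enorm_eq0 u0) -(scale0r 0) edotZl mul0r.
have [v0|vn0] := eqVneq (enorm v) 0.
  by rewrite v0 mulr0 (enorm_eq0 v0) edotC -(scale0r 0) edotZl mul0r.
have up : 0 < enorm u * enorm v.
  by rewrite mulr_gt0// lt_def enorm_ge0 ?un0 ?vn0.
(* this vector vanishes exactly when u and v are positively proportional *)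
have := edot_ge0 (enorm v *: u - enorm u *: v).
rewrite edotDl edotNl !edotZl !(edotC _ (_ - _)) !edotDl !edotNl !edotZl.
rewrite -!sqr_enorm (edotC v u).
by move=> H; rewrite -(ler_pM2l up); lra.
Qed.

Lemma is_derive_edot u v :
  is_derive u v (fun x : 'rV[R]_p => edot x x) (2 * edot v u).
Proof.
have -> : (fun x : 'rV[R]_p => edot x x) =
    \sum_(i < p) ((fun x : 'rV[R]_p => x 0 i) * (fun x : 'rV[R]_p => x 0 i)).
  by apply/funext => x; rewrite fct_sumE.
have D i : is_derive u v (fun x : 'rV[R]_p => x 0 i) (v 0 i).
  have dc : differentiable (fun x : 'rV[R]_p => x 0 i) u.
    exact: differentiable_coord.
  split; first exact: diff_derivable.
  have lin : linear (fun x : 'rV[R]_p => x 0 i) by move=> a x y; rewrite !mxE.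
  pose lM := GRing.isLinear.Build _ _ _ _ _ lin.
  pose l : {linear 'rV[R]_p -> R} := HB.pack (fun x : 'rV[R]_p => x 0 i) lM.
  rewrite deriveE// (_ : (fun x : 'rV[R]_p => x 0 i) = l)// diff_lin//.
  exact: coord_continuous.
apply: is_derive_eq.
rewrite /edot mulr_sumr; apply: eq_bigr => i _; rewrite /GRing.scale/=; ring.
Qed.

Lemma differentiable_edot u : differentiable (fun x : 'rV[R]_p => edot x x) u.
Proof.
have -> : (fun x : 'rV[R]_p => edot x x) =
    \sum_(i < p) ((fun x : 'rV[R]_p => x 0 i) * (fun x : 'rV[R]_p => x 0 i)).
  by apply/funext => x; rewrite fct_sumE.
apply: differentiable_sum => i.
by apply: differentiableM; exact: differentiable_coord.
Qed.

Lemma enorm_continuous : continuous (@enorm R p).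
Proof.
move=> u; apply: (@continuous_comp _ _ _ (fun x : 'rV[R]_p => edot x x)).
  exact/differentiable_continuous/differentiable_edot.
exact: sqrt_continuous.
Qed.

Lemma ray_derive_edot (w dw : R -> 'rV[R]_p) : ray_derive w dw ->
  ray_derive (fun t => edot (w t) (w t)) (fun t => 2 * edot (dw t) (w t)).
Proof.
move=> wd; have := ray_derive_comp differentiable_edot wd.
congr ray_derive; apply/funext => t.
rewrite -deriveE; last exact: differentiable_edot.
by have D := is_derive_edot (w t) (dw t); rewrite derive_val.
Qed.

Section maps.
Context {F : normedModType R}.

(** The constant is crude, but it shows that the set whose supremum defines
    [opnorm] is bounded, without which [opnorm] would be 0 by convention. *)
Lemma linear_le_enorm (L : {linear 'rV[R]_p -> F}) v :
  `|L v| <= (\sum_(i < p) `|L (delta_mx 0 i)|) * enorm v.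
Proof.
rewrite {1}(row_sum_delta v) linear_sum mulr_suml.
rewrite (le_trans (ler_norm_sum _ _ _))//.
apply: ler_sum => i _; rewrite linearZ normrZ mulrC ler_wpM2l//.
exact: coord_le_enorm.
Qed.

Lemma le_opnorm (L : {linear 'rV[R]_p -> F}) v : `|L v| <= opnorm L * enorm v.
Proof.
have [v0|vn0] := eqVneq (enorm v) 0.
  by rewrite v0 mulr0 (enorm_eq0 v0) linear0 normr0.
have vp : 0 < enorm v by rewrite lt_def vn0 enorm_ge0.
rewrite -ler_pdivrMr//.
have -> : `|L v| / enorm v = `|L ((enorm v)^-1 *: v)|.
  by rewrite linearZ normrZ normfV (ger0_norm (enorm_ge0 v)) mulrC.
apply: ub_le_sup.
  exists (\sum_(i < p) `|L (delta_mx 0 i)|) => _ [x /= x1 <-].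
  rewrite (le_trans (linear_le_enorm _ _))// ler_piMr// sumr_ge0//.
exists ((enorm v)^-1 *: v) => //=.
by rewrite enormZ normfV (ger0_norm (enorm_ge0 v)) mulVf.
Qed.

(** The topology on row vectors is that of the sup norm, so that Euclidean
    balls are open is a consequence of the continuity of [enorm]. *)
Lemma eball_nbhs (c u : 'rV[R]_p) (r : R) : eball c r u -> \near u, eball c r u.
Proof.
move=> cu.
have : (fun x : 'rV[R]_p => enorm (x - c)) @ u --> enorm (u - c).
  apply: (@cvg_comp _ _ _ (fun x : 'rV[R]_p => x - c) (@enorm R p) _
    (nbhs (u - c))).
    by apply: (@cvgB _ _ _ (nbhs u) _ id (cst c) u c) => //; exact: cvg_cst.
  exact: enorm_continuous.
by move=> H; exact: (@cvgr_lt _ _ (nbhs u) _ _ _ H r cu).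
Qed.

(** The differential is a limit of difference quotients, each bounded by the
    Lipschitz constant once the increment stays in the open ball. *)
Lemma diff_le_elipschitz (k r : R) (c u : 'rV[R]_p) (f : 'rV[R]_p -> F) v :
  elipschitz k (eball c r) f -> eball c r u -> differentiable f u ->
  `|'d f u v| <= k * enorm v.
Proof.
move=> fk uc fd; rewrite -deriveE//.
have dv : derivable f u v by exact: diff_derivable.
rewrite /derive.
set q := (X in lim (X @ _)).
have : `|q s| @[s --> 0^'] --> `|lim (q @ 0^')| by exact: cvg_norm.
move/cvgr_to_le; apply.
have H : \forall s \near (0 : R)^', eball c r (s *: v + u).
  apply: nbhs_dnbhs.
  have : (fun s : R => s *: v + u) @ (0 : R) --> u.
    rewrite -[X in _ --> X]add0r -(scale0r v).
    by apply: cvgD; [exact: cvgZr_tmp|exact: cvg_cst].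
  by apply; exact: eball_nbhs.
apply: filterS2 (nbhs_dnbhs_neq 0) H => s s0 sc.
rewrite /q normrZ normfV mulrC ler_pdivrMr ?normr_gt0//=.
by rewrite (le_trans (fk _ _ sc uc))// addrK enormZ -mulrA (mulrC (enorm v)).
Qed.
End maps.

Section adjoint.
Context {F : hilbertType R}.

(** Test the adjoint against itself: |L^T y|^2 = <L (L^T y), y>. *)
Lemma enorm_adjoint_le (L : {linear 'rV[R]_p -> F}) (C : R) (y : F) :
  0 <= C -> (forall v, `|L v| <= C * enorm v) ->
  enorm (adjoint L y) <= C * `|y|.
Proof.
move=> C0 LC; set a := adjoint L y.
have [->|an0] := eqVneq (enorm a) 0.
  by rewrite mulr_ge0.
have ap : 0 < enorm a by rewrite lt_def an0 enorm_ge0.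
rewrite -(ler_pM2l ap) -expr2 sqr_enorm -adjointP.
rewrite (le_trans (ler_norm _))// (le_trans (ler_inner _ _))//.
by rewrite mulrA ler_wpM2r// mulrC LC.
Qed.

Lemma adjointBl (L1 L2 : 'rV[R]_p -> F) y :
  adjoint (fun v => L1 v - L2 v) y = adjoint L1 y - adjoint L2 y.
Proof. by apply/rowP => i; rewrite !mxE linearBl. Qed.

Lemma adjointBr (L : 'rV[R]_p -> F) y z :
  adjoint L (y - z) = adjoint L y - adjoint L z.
Proof. by apply/rowP => i; rewrite !mxE linearB. Qed.

(** With d = e - e0, splitting A0^T e0 = A0^T e - A0^T d turns the left-hand
    side into
      <A0^T e, (A0 - A)^T d> + <(A0 - A)^T e, A^T d> - |A0^T d|^2.
    The last term has a favourable sign, and each of the first two costs one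
    factor C and one factor k. *)
Lemma gram_gap (A A0 : {linear 'rV[R]_p -> F}) (C k : R) (e e0 : F) :
  0 <= C -> 0 <= k ->
  (forall v, `|A v| <= C * enorm v) -> (forall v, `|A0 v| <= C * enorm v) ->
  (forall v, `|A v - A0 v| <= k * enorm v) ->
  inner (A0 (adjoint A0 e0) - A (adjoint A e)) (e - e0) <=
    2 * C * k * `|e| * `|e - e0| :> R.
Proof.
move=> C0 k0 AC A0C Ak; set d := e - e0.
rewrite linearBl/= !adjointP.
have -> : adjoint A0 e0 = adjoint A0 e - adjoint A0 d.
  by rewrite -adjointBr /d subKr.
have Dk y : enorm (adjoint A y - adjoint A0 y) <= k * `|y|.
  rewrite -adjointBl.
  exact: (@enorm_adjoint_le (A \- A0 : {linear _ -> _})).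
have := Dk e; have := Dk d.
have := enorm_adjoint_le d C0 AC; have := enorm_adjoint_le e C0 A0C.
set a := adjoint A e; set b := adjoint A d.
set a0 := adjoint A0 e; set b0 := adjoint A0 d.
move=> a0C bC bk ak.
have -> : edot (a0 - b0) b0 - edot a b =
    edot a0 (b0 - b) + edot (a0 - a) b - edot b0 b0.
  rewrite !edotDl !edotNl !(edotC a0 (_ - _)) !edotDl !edotNl.
  rewrite (edotC b a0) (edotC b0 a0); ring.
have := edot_ge0 b0.
have : edot a0 (b0 - b) <= C * `|e| * (k * `|d|).
  by rewrite (le_trans (edot_le_enorm _ _))// ler_pM ?enorm_ge0// -enormN opprB.
have : edot (a0 - a) b <= k * `|e| * (C * `|d|).
  by rewrite (le_trans (edot_le_enorm _ _))// ler_pM ?enorm_ge0// -enormN opprB.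
lra.
Qed.
End adjoint.
End Euclid.

(** * Gradient flows of the square loss *)

Section Flows.
Context {R : realType} {p : nat} {F : hilbertType R}.

Lemma ray_derive_sqr_norm (f df : R -> F) : ray_derive f df ->
  ray_derive (fun t => `|f t| ^+ 2) (fun t => 2 * inner (df t) (f t)).
Proof.
move=> fd.
have E : 2 *: square_loss (0 : F) = (fun y : F => `|y| ^+ 2).
  apply/funext => y; rewrite -[LHS]/(2 * (2^-1 * `|y - 0| ^+ 2)) subr0.
  by rewrite mulrA divff ?mul1r.
have D y : is_diff y (fun y : F => `|y| ^+ 2)
    (fun v : F => 2 * inner v (y - 0) : R).
  by rewrite -E; apply: is_diffZ; exact: is_diff_square_loss.
have dD y : differentiable (fun y : F => `|y| ^+ 2) y by have [] := D y.
have := ray_derive_comp dD fd; congr ray_derive; apply/funext => t.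
by have Dt := D (f t); rewrite diff_val/= subr0.
Qed.

Lemma is_diff_linearized (h : 'rV[R]_p -> F) w0 u :
  differentiable h w0 -> is_diff u (linearized h w0) ('d h w0).
Proof.
move=> hd.
have D x : is_diff x ('d h w0) ('d h w0).
  apply: DiffDef; first exact: linear_differentiable (diff_continuous hd).
  exact: diff_lin (diff_continuous hd).
have E : is_diff u (fun x : 'rV[R]_p => x - w0) id.
  by apply: is_diff_eq; rewrite subr0.
by apply: (@is_diff_eq _ _ _ _ (0 + ('d h w0 \o id))); rewrite add0r.
Qed.

Lemma diff_linearized (h : 'rV[R]_p -> F) w0 u :
  differentiable h w0 -> 'd (linearized h w0) u = 'd h w0 :> ('rV[R]_p -> F).
Proof. by move=> hd; have D := is_diff_linearized u hd; exact: diff_val. Qed.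

(** Right continuity at 0 follows from the existence of the right derivative,
    as w s = s *: (s^-1 *: (w s - w 0)) + w 0 for s > 0. *)
Lemma gradient_flow_ray_derive (f : 'rV[R]_p -> R) w0 w :
  gradient_flow f w0 w -> ray_derive w (fun t => - grad f (w t)).
Proof.
move=> [_ w0d wd]; split=> //.
have : (fun s : R => s *: (s^-1 *: (w s - w 0)) + w 0) @ (0 : R)^'+ --> w 0.
  rewrite -[X in _ --> X]add0r -(scale0r (- grad f (w 0))).
  apply: cvgD; last exact: cvg_cst.
  by apply: cvgZ => //; exact: cvg_at_right_filter.
apply: cvg_trans; apply: near_eq_cvg.
(* s is nonzero since it ranges over a right neighbourhood of 0 *)
near=> s; rewrite scalerA divff ?scale1r ?subrK//.
Unshelve. all: by end_near. Qed.

(** The factor 1 / alpha of the gradient cancels the scaling of the output, so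
    the residual obeys e' = - A A^T e whatever alpha. The differential of g is
    given as a separate function A because for the linearized model it is
    known to be constant. *)
Lemma residual_ray_derive (g : 'rV[R]_p -> F) (A : 'rV[R]_p -> 'rV[R]_p -> F)
    ystar (alpha : R) w0 w :
  alpha != 0 -> (forall u, differentiable g u) ->
  (forall u, 'd g u = A u :> ('rV[R]_p -> F)) ->
  gradient_flow (scaled_objective (square_loss ystar) alpha g) w0 w ->
  ray_derive (fun t => alpha *: g (w t) - ystar)
    (fun t => - A (w t) (adjoint (A (w t)) (alpha *: g (w t) - ystar))).
Proof.
move=> a0 gd gA /gradient_flow_ray_derive wc.
have agd u : differentiable (alpha *: g) u by exact: differentiableZ.
have := ray_deriveB (ray_derive_comp agd wc) (ray_derive_cst ystar).
congr ray_derive; apply/funext => t /=.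
rewrite subr0 diffZ// grad_scaled_square_loss//.
by rewrite [LHS]/= linearN linearZ/= scalerN scalerA divff// scale1r gA.
Qed.

(** Along the flow, (|e|^2)' = - 2 |A^T e|^2. *)
Lemma residual_le (g : 'rV[R]_p -> F) ystar (alpha : R) w0 w t :
  alpha != 0 -> (forall u, differentiable g u) ->
  gradient_flow (scaled_objective (square_loss ystar) alpha g) w0 w ->
  0 <= t -> `|alpha *: g (w t) - ystar| <= `|alpha *: g w0 - ystar|.
Proof.
move=> a0 gd gf t0.
have <- : w 0 = w0 by case: gf.
rewrite -(@ler_pXn2r _ 2) ?nnegrE//.
have ec := residual_ray_derive a0 gd (fun u => erefl) gf.
apply: (ray_derive_nonincreasing t0 (ray_derive_sqr_norm ec)).
move=> s _; rewrite linearNl/= adjointP.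
by rewrite mulrN oppr_le0 mulr_ge0// edot_ge0.
Qed.

(** Inside the ball the speed of the flow is at most Liph * D / alpha because
    the residual never exceeds its initial norm D; the flow therefore cannot
    cover the distance r before the time at which this speed would reach it.
    The argument is run at the first exit time: up to that time the speed
    bound is valid, and at that time it contradicts the exit. *)
Lemma gradient_flow_drift (h : 'rV[R]_p -> F) ystar (r Liph alpha T : R) w0 w
    (D := `|alpha *: h w0 - ystar|) :
  0 < alpha -> 0 < Liph -> 0 < D ->
  (forall u, differentiable h u) -> elipschitz Liph (eball w0 r) h ->
  gradient_flow (scaled_objective (square_loss ystar) alpha h) w0 w ->
  Liph * D / alpha * T <= r ->
  forall t, 0 <= t < T ->
    enorm (w t - w0) < r /\ enorm (w t - w0) <= Liph * D / alpha * t.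
Proof.
move=> alpha_gt0 Liph_gt0 D0 h_diff h_lip w_flow.
have a0 : alpha != 0 by rewrite gt_eqF.
have w00 : w 0 = w0 by case: w_flow.
pose e t := alpha *: h (w t) - ystar.
have eD t : 0 <= t -> `|e t| <= D by exact: residual_le w_flow.
set v := Liph * D / alpha => vT.
have v0 : 0 < v by rewrite divr_gt0// mulr_gt0.
pose phi t := enorm (w t - w0).
have wc := gradient_flow_ray_derive w_flow.
have dc := ray_deriveB wc (ray_derive_cst w0).
have drift b : 0 <= b -> (forall s, 0 <= s < b -> phi s < r) -> phi b <= v * b.
  move=> b0 sr.
  have vc : ray_derive (fun t : R => v * t) (fun=> v).
    split=> [|t t0]; last by apply: is_derive_eq; rewrite /GRing.scale/=; ring.
    apply: cvg_at_right_filter; apply: cvgM; [exact: cvg_cst|exact: cvg_id].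
  rewrite -[leRHS]subr0 -(mulr0 v).
  apply: (sqrt_growth b0 (ray_derive_edot dc) vc).
  - by move=> t; exact: edot_ge0.
  - by rewrite /= w00 subrr -(scale0r 0) edotZl mul0r.
  - by move=> t _; exact: ltW.
  move=> t /andP[t0 tb] /=; rewrite -mulrA ler_pM2l// subr0.
  rewrite (le_trans (edot_le_enorm _ _))// ler_wpM2r ?enorm_ge0//.
  rewrite enormN grad_scaled_square_loss// enormZ gtr0_norm ?invr_gt0//.
  rewrite mulrC ler_pM2r ?invr_gt0//.
  have wt : eball w0 r (w t) by apply: sr; rewrite (ltW t0).
  have := enorm_adjoint_le (e t) (ltW Liph_gt0)
    (fun v => diff_le_elipschitz v h_lip wt (h_diff (w t))).
  move/le_trans; apply; by rewrite ler_pM2l// eD// ltW.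
have inball b : 0 <= b < T -> phi b < r.
  move=> /andP[b0 bT]; rewrite ltNge; apply/negP => rb.
  have [|tau /andP[tau0 taub] [rtau sr]] := first_exit b0 _ rb.
    move=> t t0; apply: (@cvg_comp _ _ _ (fun t => w t - w0) (@enorm R p) _
      (nbhs (w t - w0))).
      exact: (ray_derive_cvg_right dc t0).
    exact: enorm_continuous.
  have := le_trans rtau (drift tau tau0 sr).
  have : v * tau < v * T by rewrite ltr_pM2l// (le_lt_trans taub).
  lra.
move=> t /andP[t0 tT]; split; first by apply: inball; rewrite t0.
apply: drift => // s /andP[s0 st].
by apply: inball; rewrite s0 (lt_trans st).
Qed.

End Flows.

(** * Distance between the two flows *)

Theorem theorem2p3 (R : realType) (p : nat) (F : hilbertType R)
    (h : 'rV[R]_p -> F) (w0 : 'rV[R]_p) (ystar : F)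
    (r Liph LipDh alpha K : R) (w wbar : R -> 'rV[R]_p)
    (h_diff : forall u, differentiable h u)
    (Dh_loclip : diff_locally_lipschitz h)
    (r_gt0 : 0 < r) (Liph_gt0 : 0 < Liph) (LipDh_ge0 : 0 <= LipDh)
    (h_lip : elipschitz Liph (eball w0 r) h)
    (Dh_lip : diff_lipschitz LipDh (eball w0 r) h)
    (alpha_gt0 : 0 < alpha) (init_neq : alpha *: h w0 != ystar)
    (w_flow : gradient_flow
       (scaled_objective (square_loss ystar) alpha h) w0 w)
    (wbar_flow : gradient_flow
       (scaled_objective (square_loss ystar) alpha (linearized h w0)) w0 wbar)
    (K_gt0 : 0 < K)
    (alpha_ge : K * `|alpha *: h w0 - ystar| / (r * Liph) <= alpha) :
  let T := K / Liph ^+ 2 in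
  `|alpha *: h (w T) - alpha *: linearized h w0 (wbar T)|
    / `|alpha *: h w0 - ystar|
  <= K ^+ 2 / alpha * (LipDh / Liph ^+ 2) * `|alpha *: h w0 - ystar|.
Proof.
cbv zeta; set T := K / Liph ^+ 2.
have a0 : alpha != 0 by rewrite gt_eqF.
set D := `|alpha *: h w0 - ystar|.
have D0 : 0 < D by rewrite normr_gt0 subr_eq0.
have T0 : 0 < T by rewrite divr_gt0// exprn_gt0.
have lin_diff u : differentiable (linearized h w0) u.
  by have [] := is_diff_linearized u (h_diff w0).
have w00 : w 0 = w0 by case: w_flow.
have wbar00 : wbar 0 = w0 by case: wbar_flow.
pose e t := alpha *: h (w t) - ystar.
pose e0 t := alpha *: linearized h w0 (wbar t) - ystar.
have eD t : 0 <= t -> `|e t| <= D by exact: residual_le w_flow.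
pose v := Liph * D / alpha.
have v0 : 0 < v by rewrite divr_gt0// mulr_gt0.
have vT : v * T <= r.
  move: alpha_ge; rewrite -/D ler_pdivrMr ?mulr_gt0// => H.
  have -> : v * T = K * D / (alpha * Liph).
    by rewrite /v /T; field; rewrite a0 gt_eqF.
  by rewrite ler_pdivrMr ?mulr_gt0//; lra.
have drift := gradient_flow_drift alpha_gt0 Liph_gt0 D0 h_diff h_lip w_flow vT.
have ec := residual_ray_derive a0 h_diff (fun u => erefl) w_flow.
have e0c := residual_ray_derive a0 lin_diff
  (fun u => diff_linearized u (h_diff w0)) wbar_flow.
pose k := Liph * LipDh * v * D.
have kc : ray_derive (fun t : R => k * t ^+ 2) (fun t => 2 * k * t).
  split=> [|t t0]; last by apply: is_derive_eq; rewrite /GRing.scale/=; ring.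
  apply: cvg_at_right_filter; apply: cvgM; first exact: cvg_cst.
  exact: exprn_continuous.
have [Lge Dge vge] := And3 (ltW Liph_gt0) (ltW D0) (ltW v0).
have k0 : 0 <= k by do 3! apply: mulr_ge0 => //.
have Dc := ray_derive_sqr_norm (ray_deriveB ec e0c).
have main : Num.sqrt (`|e T - e0 T| ^+ 2) <= k * T ^+ 2 - k * 0 ^+ 2.
  apply: (sqrt_growth (ltW T0) Dc kc).
  - by move=> t; rewrite sqr_ge0.
  - rewrite /= w00 wbar00 /linearized subrr linear0 addr0 subrr.
    by rewrite normr0 expr0n.
  - by move=> t /andP[/ltW t0 _]; apply: mulr_ge0 => //; apply: mulr_ge0.
  move=> t /andP[t0 tT] /=.
  rewrite -/(e t) -/(e0 t) sqrtr_sqr normr_id.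
  rewrite opprK addrC.
  have wt : eball w0 r (w t) by apply: (drift t _).1; rewrite ltW.
  have w0b : eball w0 r w0.
    by rewrite /eball/= subrr -(scale0r 0) enormZ normr0 mul0r.
  have G := @gram_gap R p F ('d h (w t)) ('d h w0) Liph
    (LipDh * enorm (w t - w0)) (e t) (e0 t).
  have {}G := G (ltW Liph_gt0) (mulr_ge0 LipDh_ge0 (enorm_ge0 _))
    (fun v => diff_le_elipschitz v h_lip wt (h_diff (w t)))
    (fun v => diff_le_elipschitz v h_lip w0b (h_diff w0)).
  rewrite -mulrA ler_pM2l//; apply: le_trans (G _) _.
    move=> x.
    have := le_opnorm ('d h (w t) \- 'd h w0 : {linear _ -> _}) x.
    move/le_trans; apply; rewrite ler_wpM2r ?enorm_ge0//.
    exact: Dh_lip.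
  have pt : enorm (w t - w0) <= v * t by apply: (drift t _).2; rewrite (ltW t0).
  have et : `|e t| <= D by apply: eD; exact: ltW.
  rewrite ler_wpM2r//.
  have -> : 2 * k * t = 2 * Liph * (LipDh * (v * t)) * D by rewrite /k; ring.
  apply: ler_pM => //.
    by do ?apply: mulr_ge0 => //; exact: enorm_ge0.
  by rewrite ler_wpM2l ?ler_wpM2l// mulr_ge0.
rewrite expr0n mulr0 subr0 sqrtr_sqr normr_id in main.
have -> : alpha *: h (w T) - alpha *: linearized h w0 (wbar T) = e T - e0 T.
  by rewrite /e /e0 opprB addrA subrK.
rewrite ler_pdivrMr// (le_trans main)//.
suff -> : k * T ^+ 2 = K ^+ 2 / alpha * (LipDh / Liph ^+ 2) * D * D by [].
by rewrite /k /v /T; field; rewrite a0 gt_eqF.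
Qed.
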